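(* Let $d>k\geq 2$ be integers, and let $s(d,k)$ be the minimum natural number $l$ such that the puzzle graph $puz[d,k,l]$ contains a configuration that is not $k$-isolated. Then the graph $puz[d,k,s(d,k)]$ contains a $k$-semi-isolated configuration and contains no $k$-mobile configurations.
   Context: Let $d\ge 1$, $1\le k\le d$, $1\le l\le 2^d$ be integers. $Q^d$ is the graph of vertices and edges of the $d$-dimensional cube, with vertex set $\{0,1\}^d$. A $k$-dimensional face ($k$-face) of $Q^d$ is a set of $2^k$ vertices obtained by fixing $d-k$ of the coordinates. $\mathcal{C}[d,l]$ is the set of all configurations of $2^d-l$ tokens, labeled $1,\dots,2^d-l$, placed on distinct vertices of $Q^d$ (so $l$ vertices are unoccupied). For a configuration $C$, $\mathcal L_C=\{1,\dots,2^d-l\}$ is its set of labels (tokens). Moves: if a token $t$ sits at a vertex of a $k$-face $\sigma$ and all remaining vertices of $\sigma$ are unoccupied, then $t$ can be moved to any other vertex of $\sigma$; this is called a $k$-move. The puzzle graph $puz[d,k,l]$ has vertex set $\mathcal{C}[d,l]$, with $C$ and $D$ joined by an edge when one is reached from the other by a single $k$-move. A configuration $C$ is $k$-isolated if no token can perform a $k$-move; it is $k$-semi-isolated if there is a non-empty proper subset $\mathcal A_C\subsetneq\mathcal L_C$ such that every configuration in the connected component of $C$ in $puz[d,k,l]$ is obtained from $C$ by a series of $k$-moves affecting only tokens in $\mathcal L_C\setminus\mathcal A_C$; it is $k$-mobile if it is neither $k$-isolated nor $k$-semi-isolated. (Since a $k$-face has $2^k$ vertices, $s(d,k)=2^k-1$.)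 *)

(* Defs.v *)
From HB Require Import structures.
From mathcomp Require Import all_boot.
Set Implicit Arguments.
Unset Strict Implicit.
Unset Printing Implicit Defensive.

Notation vertex d := {ffun 'I_d -> bool}.

Definition kface (d k : nat) (F : {set vertex d}) : bool :=
  [exists S : {set 'I_d}, exists a : vertex d,
     (#|S| == d - k) && (F == [set v : vertex d | [forall i in S, v i == a i]])].

(* The tokens 1, ..., 2^d - l are represented by 0, ..., 2^d - l - 1, and a
   configuration by the injective map sending each token to its vertex. *)
Notation token d l := 'I_(2 ^ d - l).

Record config (d l : nat) := Config {
  place :> {ffun token d l -> vertex d};
  _ : injectiveb place }.

HB.instance Definition _ (d l : nat) := [isSub for @place d l].
HB.instance Definition _ (d l : nat) := [Finite of config d l by <:].

Definition token_move (d k l : nat) (t : token d l) (C D : config d l) : bool :=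
  [exists F : {set vertex d},
     [&& kface k F, C t \in F, [forall u, (C u \in F) ==> (u == t)],
         D t \in F, D t != C t & [forall u, (u != t) ==> (D u == C u)]]].

Definition puz (d k l : nat) : rel (config d l) :=
  fun C D => [exists t, token_move k t C D || token_move k t D C].

Definition isolated (d k l : nat) (C : config d l) : bool :=
  ~~ [exists t, exists D, token_move k t C D].

Definition semi_isolated (d k l : nat) (C : config d l) : bool :=
  [exists A : {set token d l},
     [&& A != set0, A \proper [set: token d l] &
         [forall D, connect (@puz d k l) C D ==>
            connect (fun X Y => [exists t in ~: A, token_move k t X Y]) C D]]].

Definition mobile (d k l : nat) (C : config d l) : bool :=
  ~~ isolated k C && ~~ semi_isolated k C.

Definition has_non_isolated (d k l : nat) : bool :=
  [exists C : config d l, ~~ isolated k C].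

(* The value 2^d is the default when no such l exists; [sminP] shows that this
   never matters for 1 <= k <= d. *)
Definition smin (d k : nat) : nat :=
  [arg min_(l < (ord_max : 'I_(2 ^ d).+1) | (0 < l) && has_non_isolated d k l) l].

Lemma ex_non_isolated (d k : nat) : 0 < k <= d ->
  exists l : 'I_(2 ^ d).+1, (0 < l) && has_non_isolated d k l.
Proof.
case/andP=> k0 kd; have d0 : 0 < d := leq_trans k0 kd.
have p2 : 1 < 2 ^ d by rewrite -{1}(expn0 2) ltn_exp2l.
have hl : (2 ^ d).-1 < (2 ^ d).+1 by rewrite ltnS leq_pred.
exists (Ordinal hl) => /=; rewrite -ltnS prednK ?p2 ?(ltnW p2) //=.
set l := (2 ^ d).-1.
have n1 : 2 ^ d - l = 1 by rewrite /l -subn1 subKn // ltnW.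
have tok1 (t u : token d l) : t = u.
  have h (v : token d l) : nat_of_ord v = 0.
    by case: v => m /=; rewrite n1 ltnS leqn0 => /eqP.
  by apply: val_inj; rewrite /= !h.
have inj (a : vertex d) : injectiveb [ffun _ : token d l => a].
  by apply/injectiveP => t u _; exact: tok1.
have t0 : token d l by rewrite n1; exact: ord0.
have [S] : exists S : {set 'I_d}, #|S| == d - k.
  have : 0 < #|[set A : {set 'I_d} | A \subset [set: 'I_d] & #|A| == d - k]|.
    by rewrite cards_draws bin_gt0 cardsT card_ord leq_subr.
  by case/card_gt0P=> S; rewrite inE => /andP[_ hS]; exists S.
move=> cS.
have [i iS] : exists i, i \notin S.
  have : 0 < #|~: S|.
    by rewrite cardsCs setCK card_ord (eqP cS) subKn.
  by case/card_gt0P=> i; rewrite inE => hi; exists i.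
pose a : vertex d := [ffun _ => false].
pose b : vertex d := [ffun j => j == i].
apply/existsP; exists (Config (inj a)); rewrite negbK.
apply/existsP; exists t0; apply/existsP; exists (Config (inj b)).
apply/existsP; exists [set v : vertex d | [forall i in S, v i == a i]].
rewrite /= !inE !ffunE; do 5?[apply/andP; split].
- by apply/existsP; exists S; apply/existsP; exists a; rewrite cS eqxx.
- by apply/forall_inP => j _; rewrite !ffunE.
- by apply/forallP => u; apply/implyP => _; rewrite (tok1 u t0).
- apply/forall_inP => j jS; rewrite !ffunE.
  by apply/eqP; apply: contraNF iS => /eqP <-.
- by apply/eqP => /ffunP /(_ i); rewrite !ffunE eqxx.
- by apply/forallP => u; rewrite (tok1 u t0) eqxx.
Qed.

Lemma sminP (d k : nat) : 0 < k <= d ->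
  [/\ 0 < smin d k <= 2 ^ d, has_non_isolated d k (smin d k) &
      forall l, 0 < l <= 2 ^ d -> has_non_isolated d k l -> smin d k <= l].
Proof.
move=> hk; have [l0 hl0] := ex_non_isolated hk.
have hmax : exists m : 'I_(2 ^ d).+1,
    [/\ (0 < m) && has_non_isolated d k m, smin d k = m &
        forall l : 'I_(2 ^ d).+1, (0 < l) && has_non_isolated d k l -> m <= l].
  rewrite /smin /arg_min /extremum; case: pickP => [m /andP[hm /forall_inP hmin]|no].
    by exists m.
  pose P (l : 'I_(2 ^ d).+1) := (0 < l) && has_non_isolated d k l.
  case: (@arg_minnP _ l0 P (fun l => val l) hl0) => m hm hmin.
  by have /negP := no m; case; rewrite /= -/(P m) hm /=; apply/forall_inP.
have [m [/andP[m0 hm] -> hmin]] := hmax; split=> //.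
  by rewrite m0 -ltnS ltn_ord.
move=> l /andP[l1 l2] hl; have l3 : l < (2 ^ d).+1 by [].
by apply: (hmin (Ordinal l3)); rewrite /= l1.
Qed.

(* Main.v *)
(** With at most [2 ^ k - 1] empty vertices, a token [t] that can move inside a
    [k]-face [F] makes [F] minus the position of [t] the whole set of empty
    vertices.  Two distinct [k]-faces share at most [2 ^ (k - 1)] vertices, which
    is less than [2 ^ k - 1] when [2 <= k], so the empty vertices determine [F]
    and hence [t].  After the move [F] is still the only available face, so [t]
    is the only token that ever moves, and all other tokens are frozen. *)
Require Import Defs.
From mathcomp Require Import all_boot.
Set Implicit Arguments.
Unset Strict Implicit.
Unset Printing Implicit Defensive.

Definition subcube (d : nat) (S : {set 'I_d}) (a : vertex d) : {set vertex d} :=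
  [set v : vertex d | [forall i in S, v i == a i]].

Lemma subcubeP (d : nat) (S : {set 'I_d}) (a v : vertex d) :
  reflect {in S, v =1 a} (v \in subcube S a).
Proof.
rewrite inE; apply: (iffP forall_inP) => [h i /h /eqP //|h i /h ->].
exact: eqxx.
Qed.

Lemma kfaceP (d k : nat) (F : {set vertex d}) :
  reflect (exists (S : {set 'I_d}) a, #|S| = d - k /\ F = subcube S a) (kface k F).
Proof.
apply: (iffP existsP) => [[S /existsP[a /andP[/eqP cS /eqP ->]]]|[S [a [cS ->]]]].
  by exists S, a.
by exists S; apply/existsP; exists a; rewrite cS !eqxx.
Qed.

Lemma subcube_eq (d : nat) (S : {set 'I_d}) (a v : vertex d) :
  v \in subcube S a -> subcube S a = subcube S v.
Proof.
move=> /subcubeP va; apply/setP => u.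
by apply/subcubeP/subcubeP => h i iS; rewrite h // va.
Qed.

(** Flipping the coordinates of [a] in a subset of [~: S] gives a bijection from [powerset (~: S)]
    onto the subcube. *)
Lemma card_subcube (d : nat) (S : {set 'I_d}) (a : vertex d) :
  #|subcube S a| = 2 ^ (d - #|S|).
Proof.
pose f (B : {set 'I_d}) : vertex d := [ffun i => a i (+) (i \in B)].
have finj : injective f.
  move=> B B' /ffunP e; apply/setP => i.
  by move: (e i); rewrite !ffunE => /addbI.
have -> : subcube S a = f @: powerset (~: S).
  apply/setP => v; apply/subcubeP/imsetP => [va|[B]].
    exists [set i | v i != a i].
      by rewrite inE; apply/subsetP => i; rewrite !inE; apply: contra => /va ->.
    by apply/ffunP => i; rewrite ffunE inE; case: (v i) (a i) => [] [].
  rewrite inE => /subsetP BS -> i iS; rewrite ffunE.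
  by case: (boolP (i \in B)) => [/BS|_]; rewrite ?inE ?iS ?addbF.
by rewrite card_imset // card_powerset cardsCs setCK card_ord.
Qed.

Lemma card_kface (d k : nat) (F : {set vertex d}) :
  k <= d -> kface k F -> #|F| = 2 ^ k.
Proof. by move=> kd /kfaceP[S [a [cS ->]]]; rewrite card_subcube cS subKn. Qed.

Lemma kface_exists (d k : nat) : exists F : {set vertex d}, kface k F.
Proof.
have : 0 < #|[set A : {set 'I_d} | A \subset [set: 'I_d] & #|A| == d - k]|.
  by rewrite cards_draws bin_gt0 cardsT card_ord leq_subr.
case/card_gt0P=> S; rewrite inE => /andP[_ /eqP cS].
by exists (subcube S [ffun=> false]); apply/kfaceP; exists S, [ffun=> false].
Qed.

Lemma card_kfaceI (d k : nat) (F G : {set vertex d}) :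
  k <= d -> kface k F -> kface k G -> F != G -> #|F :&: G| <= 2 ^ k.-1.
Proof.
move=> kd /kfaceP[S [a [cS eF]]] /kfaceP[T [b [cT eG]]] FG.
have [->|[v]] := set_0Vmem (F :&: G); first by rewrite cards0.
rewrite inE eF eG => /andP[va vb].
(* Rebase both faces at the common vertex [v], so that they differ only in their sets of fixed
   coordinates. *)
rewrite eF eG (subcube_eq va) (subcube_eq vb) in FG *.
have /subsetPn[i iT iS] : ~~ (T \subset S).
  apply: contra FG => TS; have /eqP -> // : T == S.
  by rewrite eqEcard TS cS cT leqnn.
(* The intersection fixes [S] and also [i], hence lies in a subcube of dimension [k.-1]. *)
have -> : k.-1 = d - #|i |: S|.
  by rewrite cardsU1 iS cS subnDA subnAC subKn // subn1.
rewrite -(card_subcube (i |: S) v); apply/subset_leq_card/subsetP => u.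
rewrite inE => /andP[/subcubeP uS /subcubeP uT]; apply/subcubeP => j.
by case/setU1P => [->|]; [exact: uT | exact: uS].
Qed.

(** The condition under which [t] can move inside [F]; a move of [t] within [F] preserves it. *)
Definition alone (d l : nat) (F : {set vertex d}) (t : token d l)
    (C : config d l) : Prop :=
  C t \in F /\ forall u, C u \in F -> u = t.

Lemma config_inj (d l : nat) (C : config d l) : injective C.
Proof. by case: C => f i; apply/injectiveP. Qed.

(** Only an inequality: for [l > 2 ^ d] the truncated subtraction leaves no tokens and just [2 ^ d]
    empty vertices. *)
Lemma card_empty (d l : nat) (C : config d l) : #|~: (C @: setT)| <= l.
Proof.
rewrite cardsCs setCK card_imset; last exact: config_inj.
by rewrite cardsT card_ord card_ffun card_bool card_ord -minnE geq_minr.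
Qed.

Lemma alone_sub_empty (d l : nat) (F : {set vertex d}) (t : token d l)
    (C : config d l) : alone F t C -> F :\ C t \subset ~: (C @: setT).
Proof.
case=> _ h; apply/subsetP => v; rewrite !inE => /andP[vt vF].
by apply: contra vt => /imsetP[u _ e]; rewrite e (h u) -?e.
Qed.

Lemma alone_unique (d k l : nat) (F G : {set vertex d}) (t u : token d l)
    (C : config d l) :
  2 <= k <= d -> l <= (2 ^ k).-1 -> kface k F -> kface k G ->
  alone F t C -> alone G u C -> u = t.
Proof.
move=> /andP[k2 kd] lk kF kG hF hG.
(* The inclusion is an equality by counting: the left side has [2 ^ k - 1] elements, and there are
   at most [l] empty vertices. *)
have full H w : kface k H -> alone H w C -> H :\ C w = ~: (C @: setT).
  move=> kH hH; apply/eqP; rewrite eqEcard alone_sub_empty //=.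
  apply: leq_trans (card_empty C) (leq_trans lk _).
  by rewrite -(card_kface kd kH) (cardsD1 (C w)) hH.1.
have [FG|FG] := eqVneq F G; first by apply: hF.2; rewrite FG hG.1.
have : F :\ C t \subset F :&: G.
  by rewrite subsetI subsetDl (full _ _ kF hF) -(full _ _ kG hG) subsetDl.
move/subset_leq_card/leq_trans => /(_ _ (card_kfaceI kd kF kG FG)).
have := card_kface kd kF; rewrite (cardsD1 (C t)) hF.1 add1n.
(* Distinct faces would give [2 ^ k - 1 <= 2 ^ k.-1], so [2 ^ k.-1 <= 1], contradicting [2 <= k].
   For [k = 1] the first bound is an equality. *)
case: k k2 {kd lk kF kG full} => [|[|m]] //= _ e.
have h : 1 < 2 ^ m.+1 by rewrite -{1}(expn0 2) ltn_exp2l.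
by rewrite -ltnS e [2 ^ m.+2]expnS mul2n -addnn -[(2 ^ m.+1).+1]addn1
  leq_add2l leqNgt h.
Qed.

(** The other tokens stay outside [F], so [t] is still alone there after the move. This makes the
    description symmetric in [C] and [D]. *)
Lemma token_moveP (d k l : nat) (t : token d l) (C D : config d l) :
  reflect (exists F, [/\ kface k F, alone F t C, alone F t D, D t != C t
                       & forall u, u != t -> D u = C u])
          (token_move k t C D).
Proof.
apply: (iffP existsP) => -[F].
  case/and5P=> kF Ct /forallP hC Dt /andP[DC /forallP hD].
  have hC' u : C u \in F -> u = t by move=> Cu; apply/eqP/(implyP (hC u)).
  have hD' u : u != t -> D u = C u by move=> ut; apply/eqP/(implyP (hD u)).
  exists F; split=> //; split=> // u Du; apply/eqP; apply: contraT => ut.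
  by move: Du; rewrite (hD' u ut) => /hC' e; rewrite e eqxx in ut.
case=> kF [Ct hC] [Dt _] DC hD; exists F.
rewrite kF Ct Dt DC /=; apply/andP; split; apply/forallP=> u; apply/implyP.
  by move/hC/eqP.
by move/hD/eqP.
Qed.

Lemma token_move_sym (d k l : nat) (t : token d l) (C D : config d l) :
  token_move k t C D -> token_move k t D C.
Proof.
case/token_moveP=> F [kF hC hD DC h]; apply/token_moveP; exists F.
by split=> // [|u /h //]; rewrite eq_sym.
Qed.

Lemma token_move_exists (d k l : nat) (F : {set vertex d}) (t : token d l)
    (C : config d l) :
  0 < k <= d -> kface k F -> alone F t C -> exists D, token_move k t C D.
Proof.
move=> /andP[k0 kd] kF hC.
have [w] : exists w, w \in F :\ C t.
  apply/card_gt0P; have := card_kface kd kF.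
  rewrite (cardsD1 (C t)) hC.1; case: #|_| => // e.
  by move: k0; rewrite -(@ltn_exp2l 2) // -e.
rewrite 2!inE => /andP[wt wF].
pose f : {ffun token d l -> vertex d} := [ffun u => if u == t then w else C u].
(* Since [t] is alone in [F], no other token occupies [w], which makes [f] injective. *)
have Cw u : C u = w -> u = t by move=> e; apply: hC.2; rewrite e.
have finj : injectiveb f.
  apply/injectiveP => u v; rewrite !ffunE.
  case: eqP => [->|ut]; case: eqP => [->|vt] //.
  - by move/esym/Cw.
  - by move/Cw.
  - exact: config_inj.
exists (Config finj); apply/token_moveP; exists F.
split=> //=; first split=> [|u]; rewrite ?ffunE ?eqxx //=.
  by case: eqP => // _; exact: hC.2.
by move=> u /negbTE ut; rewrite ffunE ut.
Qed.

Lemma non_isolatedP (d k l : nat) (C : config d l) : 0 < k <= d ->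
  reflect (exists F t, kface k F /\ alone F t C) (~~ isolated k C).
Proof.
move=> kd; rewrite negbK; apply: (iffP existsP) => [[t /existsP[D]]|[F [t []]]].
  by case/token_moveP=> F [kF hC _ _ _]; exists F, t.
by move=> kF /(token_move_exists kd kF) [D hD]; exists t; apply/existsP; exists D.
Qed.

(** Fill every vertex outside a [k]-face and exactly one vertex [v] of it: [2 ^ k - 1] vertices stay
    empty, and the token at [v] can move. *)
Lemma smin_le (d k : nat) : 0 < k <= d -> smin d k <= (2 ^ k).-1.
Proof.
move=> hk; have /andP[k0 kd] := hk; have [_ _] := sminP hk; apply.
  rewrite -ltnS prednK ?expn_gt0 // -{1}(expn0 2) ltn_exp2l // k0 /=.
  by rewrite (leq_trans (leq_pred _)) // leq_exp2l.
set l := (2 ^ k).-1; have [F kF] := kface_exists d k.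
have cF := card_kface kd kF.
have /card_gt0P[v vF] : 0 < #|F| by rewrite cF expn_gt0.
have cW : 2 ^ d - l = #|v |: ~: F|.
  rewrite cardsU1 inE vF cardsCs setCK card_ffun card_bool card_ord cF /= add1n.
  by rewrite -subSn ?leq_exp2l // -(prednK (expn_gt0 2 k)) subSS.
pose f : {ffun token d l -> vertex d} := [ffun t => enum_val (cast_ord cW t)].
have finj : injectiveb f.
  by apply/injectiveP => t u; rewrite !ffunE => /enum_val_inj/cast_ord_inj.
have fW t : f t \in v |: ~: F by rewrite ffunE; exact: enum_valP.
have fv t : f t \in F -> f t = v.
  by move=> fF; case/setU1P: (fW t) => //; rewrite inE fF.
pose t := cast_ord (esym cW) (enum_rank_in (setU11 v (~: F)) v).
have ft : f t = v by rewrite ffunE cast_ordKV enum_rankK_in ?setU11.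
apply/existsP; exists (Config finj); apply/(non_isolatedP _ hk).
exists F, t; split=> //; split=> [|u /fv e] /=; first by rewrite ft.
by apply: (injectiveP _ finj); rewrite e ft.
Qed.

Lemma non_isolated_semi_isolated (d k l : nat) (C : config d l) :
  2 <= k -> k < d -> l <= (2 ^ k).-1 -> ~~ isolated k C -> semi_isolated k C.
Proof.
move=> k2 kd lk; have k0 : 0 < k by exact: ltnW.
have kd' : 2 <= k <= d by rewrite k2 ltnW.
case/non_isolatedP => [|F [t [kF hC]]]; first by rewrite k0 ltnW.
apply/existsP; exists [set~ t]; apply/and3P; split.
- rewrite -card_gt0 cardsC1 card_ord -ltnS prednK; last first.
    by case: (2 ^ d - l) t {C hC} => [[]|].
  have h : 2 ^ k + 2 ^ k <= 2 ^ d by rewrite addnn -mul2n -expnS leq_exp2l.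
  rewrite ltn_subRL; apply: leq_trans h; rewrite -addnS leq_add //.
  + exact: leq_trans lk (leq_pred _).
  + by rewrite -{1}(expn0 2) ltn_exp2l.
- by rewrite properT; apply/eqP => /setP/(_ t); rewrite !inE eqxx.
apply/forallP => D; apply/implyP => /connectP[p pC ->] {D}.
(* The invariant along the path is that [t] is alone in some [k]-face, so [C] and [F] vary in the
   induction. *)
elim: p C F kF hC pC => [|D p IH] C F kF hC /=; first by rewrite connect0.
case/andP=> /existsP[u CD] pD.
(* Edges of [puz] are undirected; reversibility orients each one along the path. *)
have {}CD : token_move k u C D by case/orP: CD => // /token_move_sym.
have /token_moveP[G [kG hCu hDu _ _]] := CD.
have eu : u = t := alone_unique kd' lk kF kG hC hCu.
rewrite {}eu {hCu} in CD hDu.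
apply: connect_trans (IH D G kG hDu pD).
by apply/connect1/existsP; exists t; rewrite !inE eqxx.
Qed.

Theorem theorem1p6 (d k : nat) (hk : 2 <= k) (hd : k < d) :
  (exists C : config d (smin d k), semi_isolated k C) /\
  ~ (exists C : config d (smin d k), mobile k C).
Proof.
have kd : 0 < k <= d by rewrite (ltnW hk) ltnW.
(* Both halves follow: a mobile configuration is non-isolated by definition, and [sminP] supplies a
   non-isolated one. *)
have semi C := @non_isolated_semi_isolated d k _ C hk hd (smin_le kd).
split; last by case=> C /andP[/semi ->].
by have [_ /existsP[C /semi hC] _] := sminP kd; exists C.
Qed.
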